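(* Let $R$ be a semicommutative ring such that for all $w\in R$ and $h\in N(R)$, $(wh)^2=0$ implies $wh=0$ and $(hw)^2=0$ implies $hw=0$. Then both $R[x]$ and $R[[x]]$ are nil-reversible.
   Context: All rings are associative with identity. For a ring $R$, $N(R)$ denotes the set of all nilpotent elements of $R$. For $a\in R$, $l(a)=\{x\in R: xa=0\}$ and $r(a)=\{x\in R: ax=0\}$. A ring $R$ is nil-reversible if $l(a)=r(a)$ for every $a\in N(R)$. A ring $R$ is semicommutative if for all $w,h\in R$, $wh=0$ implies $wRh=0$. *)

(* Defs.v *)
From HB Require Import structures.
From mathcomp Require Import all_boot all_algebra.
From mathcomp Require Import boolp classical_sets.

Set Implicit Arguments.
Unset Strict Implicit.
Unset Printing Implicit Defensive.

Import GRing.Theory.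

Local Open Scope ring_scope.
Local Open Scope classical_set_scope.

Definition nilpotents (R : pzRingType) : set R :=
  [set a | exists2 n : nat, (0 < n)%N & a ^+ n = 0].

Arguments nilpotents : clear implicits.

Definition left_ann (R : pzRingType) (a : R) : set R := [set x | x * a = 0].

Definition right_ann (R : pzRingType) (a : R) : set R := [set x | a * x = 0].

Definition nil_reversible (R : pzRingType) : Prop :=
  forall a : R, nilpotents R a -> left_ann a = right_ann a.

Definition semicommutative (R : pzRingType) : Prop :=
  forall w h : R, w * h = 0 -> forall r : R, w * r * h = 0.

(* The variable commutes with the coefficients, as in {poly R}. *)
Record powerseries (R : Type) := PowerSeries { coefps : nat -> R }.

Notation "{ 'series' R }" := (powerseries R)
  (at level 0, format "{ 'series'  R }") : type_scope.

Lemma coefps_inj (R : Type) : injective (@coefps R).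
Proof. by case=> f [g] /= ->. Qed.

Lemma powerseriesP (R : Type) (f g : {series R}) :
  (forall n, coefps f n = coefps g n) -> f = g.
Proof. by move=> fg; apply: coefps_inj; apply: funext. Qed.

HB.instance Definition _ (R : Type) := gen_eqMixin {series R}.
HB.instance Definition _ (R : Type) := gen_choiceMixin {series R}.

Section PowerSeriesRing.
Variable R : pzRingType.
Implicit Types f g h : {series R}.

Definition zero_ps : {series R} := PowerSeries (fun=> 0).

Definition opp_ps f : {series R} := PowerSeries (fun n => - coefps f n).

Definition add_ps f g : {series R} :=
  PowerSeries (fun n => coefps f n + coefps g n).

Definition one_ps : {series R} := PowerSeries (fun n => (n == 0%N)%:R).

Definition mul_ps f g : {series R} :=
  PowerSeries (fun n => \sum_(i < n.+1) coefps f i * coefps g (n - i)).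

Fact add_psA : associative add_ps.
Proof. by move=> f g h; apply: powerseriesP => n /=; rewrite addrA. Qed.

Fact add_psC : commutative add_ps.
Proof. by move=> f g; apply: powerseriesP => n /=; rewrite addrC. Qed.

Fact add_0ps : left_id zero_ps add_ps.
Proof. by move=> f; apply: powerseriesP => n /=; rewrite add0r. Qed.

Fact add_Nps : left_inverse zero_ps opp_ps add_ps.
Proof. by move=> f; apply: powerseriesP => n /=; rewrite addNr. Qed.

HB.instance Definition _ :=
  GRing.isZmodule.Build {series R} add_psA add_psC add_0ps add_Nps.

Fact coef_mul_ps_rev f g n :
  coefps (mul_ps f g) n = \sum_(i < n.+1) coefps f (n - i) * coefps g i.
Proof.
rewrite /= (reindex_inj rev_ord_inj) /=.
by apply: eq_bigr => i _; rewrite (sub_ordK i).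
Qed.

Fact mul_psA : associative mul_ps.
Proof.
move=> f g h; apply: powerseriesP => n.
rewrite [LHS]/= coef_mul_ps_rev.
pose coef3 j k := coefps f j * (coefps g (n - j - k) * coefps h k).
transitivity (\sum_(j < n.+1) \sum_(k < n.+1 | (k <= n - j)%N) coef3 j k).
  apply: eq_bigr => /= j _.
  rewrite [X in _ * X](coef_mul_ps_rev g h (n - j)) big_distrr /=.
  by rewrite (big_ord_narrow_leq (leq_subr _ _)).
rewrite (exchange_big_dep predT) //=; apply: eq_bigr => k _.
transitivity (\sum_(j < n.+1 | (j <= n - k)%N) coef3 j k).
  apply: eq_bigl => j; rewrite -ltnS -(ltnS j) -!subSn ?leq_ord //.
  by rewrite -subn_gt0 -(subn_gt0 j) -!subnDA addnC.
rewrite (big_ord_narrow_leq (leq_subr _ _)) big_distrl /=.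
by apply: eq_bigr => j _; rewrite /coef3 -!subnDA addnC mulrA.
Qed.

Fact mul_1ps : left_id one_ps mul_ps.
Proof.
move=> f; apply: powerseriesP => n /=.
rewrite big_ord_recl /= mul1r subn0 big1 ?addr0 // => i _.
by rewrite mul0r.
Qed.

Fact mul_ps1 : right_id one_ps mul_ps.
Proof.
move=> f; apply: powerseriesP => n; rewrite coef_mul_ps_rev /=.
rewrite big_ord_recl /= mulr1 subn0 big1 ?addr0 // => i _.
by rewrite mulr0.
Qed.

Fact mul_psDl : left_distributive mul_ps +%R.
Proof.
move=> f g h; apply: powerseriesP => n /=; rewrite -big_split /=.
by apply: eq_bigr => i _; rewrite mulrDl.
Qed.

Fact mul_psDr : right_distributive mul_ps +%R.
Proof.
move=> f g h; apply: powerseriesP => n /=; rewrite -big_split /=.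
by apply: eq_bigr => i _; rewrite mulrDr.
Qed.

HB.instance Definition _ := GRing.Zmodule_isPzRing.Build {series R}
  mul_psA mul_1ps mul_ps1 mul_psDl mul_psDr.

Lemma coefps1 n : coefps (1 : {series R}) n = (n == 0%N)%:R.
Proof. by []. Qed.

Lemma coefpsD f g n : coefps (f + g) n = coefps f n + coefps g n.
Proof. by []. Qed.

Lemma coefpsM f g n :
  coefps (f * g) n = \sum_(i < n.+1) coefps f i * coefps g (n - i).
Proof. by []. Qed.

End PowerSeriesRing.

(* Main.v *)
Require Import Defs.
From HB Require Import structures.
From mathcomp Require Import all_boot all_algebra.
From mathcomp Require Import boolp classical_sets.

(** Taking [w = 1], the hypothesis on squares says that a nilpotent [h] with
    [h ^+ 2 = 0] vanishes; as an element of square zero is itself nilpotent, [R]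
    is reduced.  Reducedness passes to [R[x]] and [R[[x]]]: if [f] is nonzero
    with lowest nonzero coefficient [a] in degree [n], then the coefficient of
    degree [2 * n] in [f ^+ 2] is [a ^+ 2], which is nonzero
    ([convolution_square_eq0]).  In a reduced ring [0] is the only nilpotent
    element, and both annihilators of [0] are the whole ring
    ([reduced_nil_reversible]). *)

Set Implicit Arguments.
Unset Strict Implicit.
Unset Printing Implicit Defensive.

Import GRing.Theory.

Local Open Scope ring_scope.

Definition reduced (R : pzRingType) : Prop := forall a : R, a ^+ 2 = 0 -> a = 0.

(** The exponent can be lowered one at a time down to [1], since
    [(a ^+ n.+1) ^+ 2] is a multiple of [a ^+ n.+2]. *)
Lemma reduced_nilpotent_eq0 (R : pzRingType) (a : R) :
  reduced R -> nilpotents R a -> a = 0.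
Proof.
move=> redR [[|n] // _]; elim: n => [|n IHn] an0; first by rewrite -[a]expr1.
apply/IHn/redR.
by rewrite -exprM muln2 -addnn addSnnS addnC exprD an0 mul0r.
Qed.

Lemma reduced_nil_reversible (R : pzRingType) : reduced R -> nil_reversible R.
Proof.
move=> redR a /(reduced_nilpotent_eq0 redR) ->.
by apply/seteqP; split=> x _; rewrite /left_ann /right_ann /= ?mulr0 ?mul0r.
Qed.

(** This is stated for bare coefficient sequences so that it serves polynomials
    and power series alike.  Once [a i = 0] for all [i < n], only the middle term
    [i = n] of the convolution in degree [2 * n] survives. *)
Lemma convolution_square_eq0 (R : pzRingType) (a : nat -> R) :
  reduced R -> (forall n, \sum_(i < n.+1) a i * a (n - i)%N = 0) ->
  forall n, a n = 0.
Proof.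
move=> redR aa0; elim/ltn_ind => n IHn.
apply: redR; rewrite -[RHS](aa0 (n + n)%N).
have lt_n2 : (n < (n + n).+1)%N by rewrite ltnS leq_addr.
rewrite (bigD1 (Ordinal lt_n2)) //= addnK big1 ?addr0 ?expr2 // => i.
rewrite -val_eqE /= neq_ltn => /orP[lt_in | lt_ni]; first by rewrite IHn ?mul0r.
by rewrite [a (_ - _)%N]IHn ?mulr0 // ltn_subLR ?ltn_add2r // -ltnS.
Qed.

Lemma reduced_poly (R : nzRingType) : reduced R -> reduced {poly R}.
Proof.
move=> redR p pp0; apply/polyP=> n; rewrite coef0.
apply: (convolution_square_eq0 (a := fun i => p`_i) redR) => m.
by rewrite -coefM -expr2 pp0 coef0.
Qed.

Lemma reduced_powerseries (R : pzRingType) : reduced R -> reduced {series R}.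
Proof.
move=> redR f ff0; apply: powerseriesP => n.
apply: (convolution_square_eq0 redR) => m.
by rewrite -coefpsM -expr2 ff0.
Qed.

Theorem proposition3p13 (R : nzRingType)
    (semicommR : semicommutative R)
    (sqR : forall w h : R, nilpotents R h ->
       ((w * h) ^+ 2 = 0 -> w * h = 0) /\ ((h * w) ^+ 2 = 0 -> h * w = 0)) :
  nil_reversible {poly R} /\ nil_reversible {series R}.
Proof.
have redR : reduced R.
  move=> a aa0; have nil_a : nilpotents R a by exists 2%N.
  by have [+ _] := sqR 1 a nil_a; rewrite mul1r; apply.
split; apply: reduced_nil_reversible.
  exact: reduced_poly.
exact: reduced_powerseries.
Qed.
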